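(* Let $n\ge1$, $k\ge2$, and let $P(\lambda)=\sum_{j=0}^k\lambda^jA_j$, $A_j\in\mathbb{R}^{n\times n}$, be a $T$-odd matrix polynomial (i.e. $A_j^T=-A_j$ for even $j$ and $A_j^T=A_j$ for odd $j$) with $A_k$ nonsingular, all of whose eigenvalues are semi-simple. Let $(X,J)\in\mathbb{R}^{n\times kn}\times\mathbb{R}^{kn\times kn}$ be a real standard pair of $P(\lambda)$ with $X=[X_1,\ldots,X_s]$, $J=\mathrm{diag}(J_1,\ldots,J_s)$, where the spectra of the $J_j$ are pairwise disjoint and $$J_j=\mathrm{diag}\left(\begin{bmatrix} \alpha_jI_{n_j} & \beta_jI_{n_j} \\ -\beta_jI_{n_j} & \alpha_jI_{n_j} \end{bmatrix},\begin{bmatrix} -\alpha_jI_{n_j} & -\beta_jI_{n_j} \\ \beta_jI_{n_j} & -\alpha_jI_{n_j} \end{bmatrix}\right),\ \alpha_j,\beta_j>0,\quad j=1,\ldots,r_1;$$ $$J_j=\begin{bmatrix} 0 & \beta_jI_{n_j} \\ -\beta_jI_{n_j} & 0 \end{bmatrix},\ \beta_j>0,\quad j=r_1+1,\ldots,r_2;$$ $$J_j=\begin{bmatrix} \alpha_jI_{n_j} & 0 \\ 0 & -\alpha_jI_{n_j} \end{bmatrix},\ \alpha_j>0,\quad j=r_2+1,\ldots,s-1;$$ and $J_s=0_{n_s\times n_s}$ (absent if $0$ is not an eigenvalue). Then there exists a real standard pair $(\tilde X,J)$ of $P(\lambda)$ such that the corresponding matrix $\tilde\Gamma\in\mathcal{S}_{(J,T,-1,1)}$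 has the structure $\tilde\Gamma=\mathrm{diag}(\tilde\Gamma_{11},\ldots,\tilde\Gamma_{ss})$ with $$\tilde\Gamma_{jj}=\begin{bmatrix} 0 & \mathfrak{I}_{2n_j} \\ \mathfrak{I}_{2n_j} & 0 \end{bmatrix}\ (1\le j\le r_1),\quad \tilde\Gamma_{jj}=\begin{bmatrix} E_{n_j} & 0 \\ 0 & E_{n_j} \end{bmatrix}\ (r_1<j\le r_2),\quad \tilde\Gamma_{jj}=\begin{bmatrix} 0 & I_{n_j} \\ I_{n_j} & 0 \end{bmatrix}\ (r_2<j\le s-1),\quad \tilde\Gamma_{ss}=E_{n_s},$$ where $\mathfrak{I}_{2n_j}=\mathrm{diag}(I_{n_j},-I_{n_j})$ and each $E_{n_j}=\mathrm{diag}(\pm1,\ldots,\pm1)$ is $n_j\times n_j$, $j=r_1+1,\ldots,r_2,s$.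
   Context: $(X,J)$ is a standard pair of $P$ if the matrix $X_L$ obtained by stacking $X,XJ,\ldots,XJ^{k-1}$ (top to bottom) is nonsingular and $\sum_{i=0}^kA_iXJ^i=0$. An eigenvalue is semi-simple if its algebraic and geometric multiplicities coincide. $\mathcal{S}_{(J,T,-1,1)}=\{S\in\mathbb{R}^{kn\times kn}:S^T=S,\ SJ^T=-JS\}$. The matrix corresponding to a standard pair $(X,J)$ of $P$ is $\Gamma=(X_L^T\mathcal{A}X_L)^{-1}$, where $\mathcal{A}\in\mathbb{R}^{kn\times kn}$ is the $k\times k$ block matrix whose $(p,q)$ block is $(-1)^{p-1}A_{p+q-1}$ if $p+q\le k+1$ and $0$ otherwise. *)

(* Defs.v *)
From mathcomp Require Import all_boot all_order all_algebra.
From mathcomp Require Import complex reals.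

Set Implicit Arguments.
Unset Strict Implicit.
Unset Printing Implicit Defensive.

Import Order.TTheory GRing.Theory Num.Theory.
Local Open Scope ring_scope.

Section MatrixPolynomial.
Context {R : realType} {n k : nat}.

(* A matrix polynomial P(lambda) = sum_j lambda^j A_j of grade k is given by
   its coefficients A_0, ..., A_k. *)
Implicit Type A : 'I_k.+1 -> 'M[R]_n.

Definition T_odd A : Prop :=
  forall j : 'I_k.+1, (A j)^T = if odd j then A j else - A j.

Definition matpoly A : 'M[{poly R}]_n :=
  \sum_(j < k.+1) 'X^j *: map_mx polyC (A j).

Definition matpoly_eval A (z : R[i]) : 'M[R[i]]_n :=
  \sum_(j < k.+1) z ^+ j *: map_mx (real_complex R) (A j).

Definition det_poly A : {poly R[i]} :=
  map_poly (real_complex R) (\det (matpoly A)).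

Definition matpoly_eigenvalue A (z : R[i]) : bool := root (det_poly A) z.

Definition alg_mult A (z : R[i]) : nat := mup z (det_poly A).

(* kermx is a row kernel, hence the transpose: this is the dimension of
   {v | P(z) v = 0}. *)
Definition geo_mult A (z : R[i]) : nat := \rank (kermx (matpoly_eval A z)^T).

Definition all_semisimple A : Prop :=
  forall z : R[i], matpoly_eigenvalue A z -> alg_mult A z = geo_mult A z.

End MatrixPolynomial.

Lemma sum_block_sizes (k n : nat) : (\sum_(i < k) n = k * n)%N.
Proof. by rewrite sum_nat_const card_ord. Qed.

Section StandardPair.
Context {R : realType} {n k : nat}.
Implicit Types (A : 'I_k.+1 -> 'M[R]_n) (X : 'M[R]_(n, k * n)).
Implicit Types (J S : 'M[R]_(k * n)).

(* X_L: the blocks X, XJ, ..., XJ^(k-1) stacked from top to bottom. *)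
Definition stack_mx X J : 'M[R]_(k * n) :=
  castmx (sum_block_sizes k n, erefl) (\mxcol_(i < k) (X *m J ^+ i)).

Definition standard_pair A X J : Prop :=
  stack_mx X J \in unitmx /\ \sum_(i < k.+1) A i *m X *m J ^+ i = 0.

(* With indices starting from 0 the (p, q) block is (-1)^p A_(p+q+1) when
   p + q + 1 <= k, and 0 otherwise; inord is only used within its range. *)
Definition calA A : 'M[R]_(k * n) :=
  castmx (sum_block_sizes k n, sum_block_sizes k n)
    (\mxblock_(p < k, q < k)
       (if (p + q + 1 <= k)%N then (-1) ^+ p *: A (inord (p + q + 1)%N) else 0)).

Definition Gamma A X J : 'M[R]_(k * n) :=
  invmx ((stack_mx X J)^T *m calA A *m stack_mx X J).

(* Membership in S_(J,T,-1,1). *)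
Definition in_S J S : Prop := S^T = S /\ S *m J^T = - (J *m S).

End StandardPair.

Definition spectrum {R : realType} {N : nat} (M : 'M[R]_N) : pred R[i] :=
  eigenvalue (map_mx (real_complex R) M).

(* The four kinds of diagonal blocks of J: eigenvalues in quadruples
   +-alpha +- i beta, in purely imaginary pairs +- i beta, in real pairs
   +-alpha, and the eigenvalue 0. *)
Variant block_kind := Quadruple | Imaginary | RealPair | Zero.

(* The index j starts from 0, so that the j-th block here is J_(j+1); the last
   block, j = s - 1, is the one of the eigenvalue 0. *)
Definition kind_of (r1 r2 s j : nat) : block_kind :=
  if (j < r1)%N then Quadruple
  else if (j < r2)%N then Imaginary
  else if (j.+1 < s)%N then RealPair
  else Zero.

Definition block_size (c : block_kind) (m : nat) : nat :=
  match c with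
  | Quadruple => ((m + m) + (m + m))%N
  | Imaginary => (m + m)%N
  | RealPair => (m + m)%N
  | Zero => m
  end.

Section Blocks.
Context {R : realType}.

(* alpha and beta are ignored where they do not occur. *)
Definition block_param_pos (c : block_kind) (alpha beta : R) : Prop :=
  match c with
  | Quadruple => 0 < alpha /\ 0 < beta
  | Imaginary => 0 < beta
  | RealPair => 0 < alpha
  | Zero => True
  end.

Definition J_block (c : block_kind) (m : nat) (alpha beta : R) :
    'M[R]_(block_size c m) :=
  match c return 'M[R]_(block_size c m) with
  | Quadruple =>
      block_mx (block_mx alpha%:M beta%:M (- beta)%:M alpha%:M) 0
               0 (block_mx (- alpha)%:M (- beta)%:M beta%:M (- alpha)%:M)
  | Imaginary => block_mx 0 beta%:M (- beta)%:M 0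
  | RealPair => block_mx alpha%:M 0 0 (- alpha)%:M
  | Zero => 0
  end.

(* E = diag(+-1, ..., +-1); e i = true stands for the sign -1. *)
Definition sign_mx (m : nat) (e : 'I_m -> bool) : 'M[R]_m :=
  diag_mx (\row_i (-1) ^+ e i).

Definition frakI (m : nat) : 'M[R]_(m + m) := block_mx 1%:M 0 0 (- 1%:M).

Definition Gamma_block (c : block_kind) (m : nat) (e : 'I_m -> bool) :
    'M[R]_(block_size c m) :=
  match c return 'M[R]_(block_size c m) with
  | Quadruple => block_mx 0 (frakI m) (frakI m) 0
  | Imaginary => block_mx (sign_mx e) 0 0 (sign_mx e)
  | RealPair => block_mx 0 1%:M 1%:M 0
  | Zero => sign_mx e
  end.

End Blocks.

(* Main.v *)
Require Import Defs.
From mathcomp Require Import all_boot all_order all_algebra.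
From mathcomp Require Import complex reals.

Set Implicit Arguments.
Unset Strict Implicit.
Unset Printing Implicit Defensive.

Import Order.TTheory GRing.Theory Num.Theory.
Local Open Scope ring_scope.

(* Put G = X_L^T calA X_L. T-oddness makes calA symmetric, and together with the
   equation sum_i A_i X J^i = 0 it gives J^T G = - G J. Replacing X by X T with
   T commuting with J replaces G by T^T G T, so it suffices to reduce G to the
   canonical matrix, which is its own inverse, by such congruences. Since every
   block J_j is similar to - J_j^T and distinct blocks have disjoint spectra,
   Sylvester's equation forces G to be block diagonal. In a block for +-beta i,
   G has the form [a, b; -b, a], i.e. it is the complex Hermitian matrix
   a + i b, and T ranges over complex matrices, so one diagonalizes a Hermitian
   form; the block for 0 is a real symmetric form, and in the remaining ones G
   is antidiagonal, [0, b; b^T, 0], and T = diag(I, b^-1 D) turns it into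
   [0, D; D, 0], with D = I for +-alpha and D = diag(I, -I) for quadruples. *)

(** * Sylvester's equation *)

Lemma intertwine_horner (F : fieldType) m n (M : 'M[F]_m.+1) (N : 'M[F]_n.+1)
    (H : 'M[F]_(m.+1, n.+1)) (p : {poly F}) :
  M *m H = H *m N -> horner_mx M p *m H = H *m horner_mx N p.
Proof.
move=> eqMN; elim/poly_ind: p => [|p a IHp].
  by rewrite !rmorph0 mul0mx mulmx0.
rewrite !rmorphD !rmorphM /= !horner_mx_C !horner_mx_X mulmxDl mulmxDr.
rewrite -mulmxA eqMN mulmxA IHp -mulmxA.
by rewrite mul_scalar_mx mul_mx_scalar.
Qed.

(** Over [R[i]], disjoint spectra make the characteristic polynomials coprime. Evaluate a Bezout
    identity for them at [M] and apply it to [H]: one term dies by Cayley-Hamilton for [M], the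
    other is carried across [H] and dies by Cayley-Hamilton for [N]. *)
Lemma sylvester_eq0 (R : realType) m n (M : 'M[R]_m) (N : 'M[R]_n)
    (H : 'M[R]_(m, n)) :
  (forall z, ~ (spectrum M z /\ spectrum N z)) ->
  M *m H = H *m N -> H = 0.
Proof.
case: m M H => [|m] M H; first by move=> *; apply/matrixP => -[].
case: n N H => [|n] N H; first by move=> *; apply/matrixP => ? -[].
move=> disj eqMN; pose f := real_complex R.
have co : coprimep (char_poly (map_mx f M)) (char_poly (map_mx f N)).
  apply/Pdiv.ClosedField.coprimepP => z Mz; apply/negP => Nz.
  by apply: (disj z); rewrite /spectrum !eigenvalue_root_char.
apply: (@map_mx_inj _ _ f); rewrite map_mx0.
have /(congr1 (map_mx f)) := eqMN; rewrite !map_mxM => {}eqMN.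
case/Bezout_eq1_coprimepP: co => -[u v] /= uv.
have <- : horner_mx (map_mx f M) 1 *m map_mx f H = map_mx f H.
  by rewrite rmorph1 mul1mx.
rewrite -uv rmorphD !rmorphM /= Cayley_Hamilton mulr0 add0r -mulmxA.
by rewrite (intertwine_horner _ eqMN) Cayley_Hamilton mulmx0 mulmx0.
Qed.

(** * Sign diagonalization of Hermitian forms *)

Section HermitianDiagonalization.
(** With [c] the identity this covers real symmetric forms (eigenvalue 0), with [c] the conjugation
    complex Hermitian forms (imaginary pairs); one induction serves both. *)
Context {F : numFieldType} {c : {rmorphism F -> F}}.
Context (cK : involutive c).
Context (normalize : forall x, c x = x -> x != 0 ->
  exists y (b : bool), c y * x * y = (-1) ^+ b).

Local Notation "M ^h" := (map_mx c M)^T (at level 2, format "M ^h").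

Let trhM m n p (M : 'M_(m, n)) (N : 'M_(n, p)) : (M *m N)^h = N^h *m M^h.
Proof. by rewrite map_mxM trmx_mul. Qed.

Let trhK m n (M : 'M_(m, n)) : M^h^h = M.
Proof. by apply/matrixP => i j; rewrite !mxE cK. Qed.

(** In the rank factorization of [v] the row factor is a nonzero scalar [r], so [v] is [r] times the
    first column of the invertible column factor. *)
Lemma unitmx_first_col n (v : 'cV[F]_(1 + n)) :
  v != 0 -> exists2 Q : 'M_(1 + n), Q \in unitmx & lsubmx Q = v.
Proof.
move=> v0; have rv : \rank v = 1%N.
  by apply/eqP; rewrite eqn_leq rank_leq_col lt0n mxrank_eq0.
have := mulmx_ebase v; rewrite rv => ev.
pose r := row_ebase v 0 0.
have Er : row_ebase v = r%:M by rewrite [LHS]mx11_scalar.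
have r0 : r != 0.
  have := row_ebase_unit v; rewrite Er unitmxE det_scalar expr1.
  by rewrite unitfE.
exists (r *: col_ebase v).
  by rewrite unitmxZ ?unitfE // col_ebase_unit.
rewrite -{2}ev Er mul_mx_scalar linearZ /=; congr (_ *: _).
have -> : pid_mx 1 = col_mx 1%:M 0 :> 'M[F]_(1 + n, 1).
  exact: pid_mx_col.
by rewrite -{2}[col_ebase v]hsubmxK mul_row_col mulmx1 mulmx0 addr0.
Qed.

Lemma anisotropic_vector n (H : 'M[F]_n) :
  H^h = H -> H != 0 -> exists v : 'cV_n, (v^h *m H *m v) 0 0 != 0.
Proof.
move=> Hh; have Hc i j : c (H i j) = H j i by rewrite -{2}Hh !mxE.
have B i j : (delta_mx i 0 : 'cV_n)^h *m H *m (delta_mx j 0 : 'cV_n)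
    = (H i j)%:M.
  by rewrite map_delta_mx trmx_delta -rowE -colE [LHS]mx11_scalar !mxE.
case/matrix0Pn => i [j Hij].
have [Hii|Hii] := eqVneq (H i i) 0; last first.
  by exists (delta_mx i 0); rewrite B mxE.
have [Hjj|Hjj] := eqVneq (H j j) 0; last first.
  by exists (delta_mx j 0); rewrite B mxE.
(* Both diagonal entries vanish; the coefficient makes each of the two cross terms equal to 1, so
   the form takes the value 2. *)
exists (delta_mx i 0 + (H i j)^-1 *: delta_mx j 0).
set u : 'cV_n := delta_mx i 0; set w : 'cV_n := delta_mx j 0.
rewrite map_mxD map_mxZ [(_ + _)^T]linearD /= [(_ *: _)^T]linearZ /=.
rewrite !mulmxDl !mulmxDr -!scalemxAr -!scalemxAl !B Hii Hjj.
rewrite !mxE eqxx !mulr0 !mulr1n fmorphV Hc mulVf // mulVf.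
  by rewrite add0r addr0 -mulr2n pnatr_eq0.
by rewrite -Hc fmorph_eq0.
Qed.

(** Induction on the size: an anisotropic vector, scaled to the value +-1, becomes the first basis
    vector; completing the square splits it off, and the induction hypothesis applies to the Schur
    complement. *)
Lemma hermitian_diag n (H : 'M[F]_n) : H^h = H -> H \in unitmx ->
  exists (T : 'M_n) (e : 'I_n -> bool),
    T^h *m H *m T = diag_mx (\row_i (-1) ^+ e i).
Proof.
elim: n H => [|n IHn] H Hh Hu.
  by exists 0, (fun=> false); apply/matrixP => -[].
have H0 : H != 0.
  apply/eqP => H0; move: Hu; rewrite H0 unitmxE det0 unitr0 //.
have [v hv] := anisotropic_vector Hh H0.
have v0 : v != 0.
  by apply: contraNneq hv => ->; rewrite mulmx0 mxE.
have [y [b yb]] : exists y (b : bool),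
    c y * (v^h *m H *m v) 0 0 * y = (-1) ^+ b.
  apply: normalize => //.
  transitivity ((v^h *m H *m v)^h 0 0); first by rewrite !mxE.
  by rewrite !trhM trhK Hh mulmxA.
have y0 : y != 0.
  apply/eqP => y0; move: yb; rewrite y0 mulr0 => /esym/eqP.
  by rewrite signr_eq0.
have yv0 : y *: v != 0 by rewrite scaler_eq0 negb_or y0.
have [Q Qu Qv] := @unitmx_first_col n _ yv0.
pose H1 : 'M_(1 + n) := Q^h *m H *m Q.
have H1h : H1^h = H1 by rewrite /H1 !trhM trhK Hh mulmxA.
have H1ul : ulsubmx H1 = ((-1) ^+ b)%:M.
  rewrite [LHS]mx11_scalar -yb; congr _%:M.
  have -> : ulsubmx H1 = (lsubmx Q)^h *m H *m lsubmx Q.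
    by rewrite map_lsubmx trmx_lsub /H1 /ulsubmx mulmx_lsub !mul_usub_mx.
  rewrite Qv map_mxZ [(_ *: _)^T]linearZ /= -scalemxAr -!scalemxAl scalerA.
  by rewrite mxE -mulrA mulrC.
pose a := ursubmx H1; pose s : F := (-1) ^+ b.
have ss : s * s = 1 by rewrite -expr2 sqrr_sign.
have cs : c s = s by rewrite rmorph_sign.
have H1dl : dlsubmx H1 = a^h.
  by rewrite -{1}H1h map_ursubmx -trmx_ursub.
have H1E : H1 = block_mx s%:M a a^h (drsubmx H1).
  by rewrite -H1dl -H1ul submxK.
(* The sign [s] is its own inverse, so [T1] clears the off-diagonal blocks and leaves the Schur
   complement [H2]. *)
pose T1 : 'M_(1 + n) := block_mx 1%:M (- s *: a) 0 1%:M.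
pose H2 := drsubmx H1 - s *: (a^h *m a).
have E : T1^h *m H1 *m T1 = block_mx s%:M 0 0 H2.
  rewrite H1E /T1 map_block_mx tr_block_mx !map_mx1 !map_mx0 !trmx1 !trmx0.
  rewrite map_mxZ linearZ /= rmorphN cs !mulmx_block !mul1mx !mul0mx !mulmx1.
  rewrite !mulmx0 !addr0 !mul_scalar_mx -!scalemxAl !mul_mx_scalar !scalerA.
  rewrite mulrN ss mulNr ss !scaleN1r !addNr mul0mx add0r addrC /H2.
  by rewrite scaleNr.
have Eu : (block_mx s%:M 0 0 H2 : 'M_(1 + n)) \in unitmx.
  rewrite -E /H1 !unitmx_mul !unitmx_tr !map_unitmx Hu Qu !andbT /=.
  by rewrite !unitmxE det_ublock !det1 mul1r unitr1.
have H2u : H2 \in unitmx.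
  by move: Eu; rewrite !unitmxE det_ublock unitrM => /andP[].
have H2h : H2^h = H2.
  rewrite /H2 map_mxB linearB /= map_mxZ linearZ /= cs trhM trhK; congr (_ - _).
  by rewrite -{2}H1h map_drsubmx trmx_drsub.
have [T2 [e T2E]] := IHn H2 H2h H2u.
exists (Q *m T1 *m block_mx 1%:M 0 0 T2).
(* Index 0 carries the sign of the vector split off, the others those of the Schur complement. *)
exists (fun i => if unlift ord0 i is Some j then e j else b).
have -> : (Q *m T1 *m block_mx 1%:M 0 0 T2)^h *m H *m
      (Q *m T1 *m block_mx 1%:M 0 0 T2) =
    (block_mx 1%:M 0 0 T2 : 'M_(1 + n))^h *m (T1^h *m H1 *m T1) *m
      block_mx 1%:M 0 0 T2.
  by rewrite !trhM /H1 !mulmxA.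
rewrite E map_block_mx tr_block_mx !map_mx1 !map_mx0 !trmx1 !trmx0.
rewrite !mulmx_block !mul1mx !mul0mx !mulmx1 !mulmx0 !addr0 !add0r mul0mx.
rewrite T2E; apply/matrixP => i j.
rewrite !mxE; case: split_ordP => i' ->; rewrite !mxE;
  case: split_ordP => j' ->; rewrite !mxE.
- by rewrite !ord1 lshift0 unlift_none.
- by rewrite ord1 -val_eqE.
- by rewrite ord1 -val_eqE.
- by rewrite !rshift1 liftK -val_eqE.
Qed.
End HermitianDiagonalization.

(** * Normal forms in each kind of block *)

Section BlockNormalForms.
Context {R : realType}.
Local Notation f := (real_complex R).

Lemma normalize_real (x : R) : x != 0 ->
  exists y (b : bool), y * x * y = (-1) ^+ b.
Proof.
move=> x0; have n0 : `|x| > 0 by rewrite normr_gt0.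
exists (Num.sqrt `|x|^-1), (x < 0).
rewrite mulrAC -expr2 sqr_sqrtr ?invr_ge0 ?normr_ge0 //.
by rewrite {2}[x]numEsign mulrCA mulVf ?mulr1 // gt_eqF.
Qed.

Lemma symmetric_diag n (H : 'M[R]_n) : H^T = H -> H \in unitmx ->
  exists (T : 'M_n) (e : 'I_n -> bool), T^T *m H *m T = sign_mx e.
Proof.
move=> Hs Hu.
have norm x : idfun x = x -> x != 0 ->
    exists (y : R) (b : bool), idfun y * x * y = (-1) ^+ b.
  by move=> _; apply: normalize_real.
have [||T [e]] := @hermitian_diag R idfun _ norm n H _ Hu => //.
  by rewrite map_mx_id.
by rewrite map_mx_id // => TE; exists T, e.
Qed.

(** The usual embedding of complex matrices into real ones. It is multiplicative and turns adjoints
    into transposes, so Hermitian congruences become real congruences. *)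
Definition realify m n (Z : 'M[R[i]]_(m, n)) : 'M[R]_(m + m, n + n) :=
  block_mx (map_mx (@complex.Re R) Z) (map_mx (@complex.Im R) Z)
    (- map_mx (@complex.Im R) Z) (map_mx (@complex.Re R) Z).

Lemma realifyM m n p (Y : 'M[R[i]]_(m, n)) (Z : 'M_(n, p)) :
  realify (Y *m Z) = realify Y *m realify Z.
Proof.
pose cRe : R[i] -> R := @complex.Re R; pose cIm : R[i] -> R := @complex.Im R.
have EIm : map_mx cIm (Y *m Z) =
    map_mx cRe Y *m map_mx cIm Z + map_mx cIm Y *m map_mx cRe Z.
  apply/matrixP => i j; rewrite !mxE -big_split /= /cIm raddf_sum.
  by apply: eq_bigr => l _; rewrite !mxE; case: (Y i l) (Z l j) => a b [a' b'].
have ERe : map_mx cRe (Y *m Z) =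
    map_mx cRe Y *m map_mx cRe Z - map_mx cIm Y *m map_mx cIm Z.
  apply/matrixP => i j; rewrite !mxE -sumrB /= /cRe raddf_sum.
  by apply: eq_bigr => l _; rewrite !mxE; case: (Y i l) (Z l j) => a b [a' b'].
rewrite /realify mulmx_block -/cRe -/cIm EIm ERe.
rewrite !mulmxN !mulNmx opprD.
by congr block_mx; rewrite // 1?addrC.
Qed.

Lemma realify_tr m n (Z : 'M[R[i]]_(m, n)) :
  realify (map_mx (@conjc R) Z)^T = (realify Z)^T.
Proof.
rewrite /realify tr_block_mx; congr block_mx; apply/matrixP => i j;
  by rewrite !mxE; case: (Z j i) => a b /=; rewrite ?opprK.
Qed.

Lemma realify_inj m n : injective (@realify m n).
Proof.
move=> Y Z /eq_block_mx[/matrixP ERe /matrixP EIm _ _]; apply/matrixP => i j.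
have := ERe i j; have := EIm i j; rewrite !mxE.
by case: (Y i j) (Z i j) => a b [a' b'] /= -> ->.
Qed.

Lemma realify0 m n : realify (0 : 'M_(m, n)) = 0.
Proof. by rewrite /realify !map_mx0 oppr0 block_mx0. Qed.

(** The left kernel of [Z] realifies into that of [realify Z], which is zero. *)
Lemma realify_unit n (Z : 'M[R[i]]_n) : realify Z \in unitmx -> Z \in unitmx.
Proof.
move=> Zu; rewrite -row_free_unit -kermx_eq0; apply/eqP/realify_inj.
apply: (row_free_inj (A := realify Z)); first by rewrite row_free_unit.
by rewrite -realifyM mulmx_ker !realify0 mul0mx.
Qed.

Lemma realify_sign n (e : 'I_n -> bool) :
  realify (diag_mx (\row_i (-1) ^+ e i)) =
  block_mx (sign_mx e) 0 0 (sign_mx e).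
Proof.
by rewrite /realify; congr block_mx; apply/matrixP => i j;
  rewrite !mxE; case: (i == j); case: (e i) => //=; rewrite ?oppr0.
Qed.

Lemma normalize_conjc (x : R[i]) : conjc x = x -> x != 0 ->
  exists y (b : bool), conjc y * x * y = (-1) ^+ b.
Proof.
case: x => a b0 [] b0E x0.
have {b0E} b0E : b0 = 0.
  by apply/eqP; rewrite -[_ == _](mulrn_eq0 b0 2) mulr2n -{1}b0E addNr.
have a0 : a != 0 by apply: contraNneq x0 => ->; rewrite b0E.
have [y [b yb]] := normalize_real a0.
exists (f y), b; rewrite b0E.
by rewrite -[_ ^+ b](rmorph_sign f) -yb !rmorphM /= oppr0.
Qed.

Lemma imaginary_normal_form m (beta : R) (G : 'M[R]_(m + m)) :
  let J := block_mx 0 beta%:M (- beta)%:M 0 : 'M_(m + m) in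
  beta != 0 -> G^T = G -> J^T *m G = - (G *m J) -> G \in unitmx ->
  exists (T : 'M_(m + m)) (e : 'I_m -> bool),
    T *m J = J *m T /\ T^T *m G *m T = block_mx (sign_mx e) 0 0 (sign_mx e).
Proof.
move=> J b0 Gs GJ Gu.
set a := ulsubmx G; set b := ursubmx G.
(* The first block row of [J^T *m G = - (G *m J)], divided by [beta], expresses the lower blocks of
   [G] through the upper ones. *)
have GE : G = block_mx a b (- b) a.
  move: GJ; rewrite /J -{1 2}[G]submxK tr_block_mx !tr_scalar_mx !trmx0.
  rewrite !mulmx_block !mul0mx !mulmx0 !add0r !addr0 !mul_scalar_mx.
  rewrite !mul_mx_scalar opp_block_mx !scaleNr !opprK.
  case/eq_block_mx => + + _ _ => e1 /oppr_inj /(scalerI b0) e2.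
  rewrite -[LHS]submxK e2; congr block_mx.
  rewrite -[dlsubmx G]opprK; congr (- _).
  by apply: (scalerI b0); rewrite scalerN.
pose H : 'M[R[i]]_m := \matrix_(i, j) (a i j +i* b i j)%C.
have HE : realify H = G.
  by rewrite GE /realify; congr block_mx; apply/matrixP => i j; rewrite !mxE.
have [||T [e TE]] := hermitian_diag (@conjcK R) normalize_conjc (H := H).
- by apply: realify_inj; rewrite realify_tr HE.
- by apply: realify_unit; rewrite HE.
(* [J] is the real form of the scalar matrix i beta, hence commutes with every [realify T]. *)
have JE : J = realify (0 +i* beta)%C%:M.
  rewrite /realify; congr block_mx; apply/matrixP => i j; rewrite !mxE;
    by case: (i == j) => //=; rewrite ?oppr0 ?mulr0n ?mulr1n.
exists (realify T), e; split.
  by rewrite JE -!realifyM scalar_mxC.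
by rewrite -realify_tr -HE -!realifyM TE realify_sign.
Qed.

Lemma scalar_mxN n (a : R) : (- a)%:M = - a%:M :> 'M_n.
Proof. exact: raddfN. Qed.

(** The hypothesis on [K] kills the diagonal blocks of [G]. The remaining block b satisfies K^T b =
    b K, as [D] does, so b^-1 D commutes with [K] and diag(I, b^-1 D) commutes with [J]. *)
Lemma off_diagonal_normal_form m (K D : 'M[R]_m) (G : 'M[R]_(m + m)) :
  let J := block_mx K 0 0 (- K) : 'M_(m + m) in
  (forall M, K^T *m M = - (M *m K) -> M = 0) ->
  D^T = D -> D *m K = K^T *m D ->
  G^T = G -> J^T *m G = - (G *m J) -> G \in unitmx ->
  exists T : 'M_(m + m),
    T *m J = J *m T /\ T^T *m G *m T = block_mx 0 D D 0.
Proof.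
move=> J K0 Ds DK Gs GJ Gu; set b := ursubmx G.
have [bK GE] : K^T *m b = b *m K /\ G = block_mx 0 b b^T 0.
  move: GJ; rewrite /J -{1 2}[G]submxK tr_block_mx !trmx0 linearN.
  rewrite !mulmx_block !mul0mx !mulmx0 !add0r !addr0 opp_block_mx.
  rewrite !mulmxN !mulNmx !opprK => /eq_block_mx[/K0 e1 e2 _ e4].
  have /K0 e4' : K^T *m drsubmx G = - (drsubmx G *m K).
    by rewrite -e4 opprK.
  by rewrite -[X in X = block_mx _ _ _ _]submxK e1 e4' trmx_ursub Gs.
(* Padding the left kernel of [b] with zeros gives rows killed by the invertible [G]. *)
have bu : b \in unitmx.
  rewrite -row_free_unit -kermx_eq0; apply/eqP.
  have /(row_free_inj (A := G)) : row_mx (kermx b) 0 *m G = 0 *m G.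
    by rewrite GE mul_row_block mulmx_ker !mulmx0 !mul0mx !addr0 row_mx0.
  by rewrite row_free_unit -row_mx0 => /(_ Gu)/eq_row_mx[].
exists (block_mx 1%:M 0 0 (invmx b *m D)).
rewrite /J tr_block_mx trmx1 !trmx0 GE !mulmx_block.
rewrite !mul1mx !mul0mx !mulmx0 !mulmx1 !add0r !addr0 mul0mx; split.
  congr block_mx; rewrite mulmxN mulNmx; congr (- _).
  have bK' : invmx b *m K^T = K *m invmx b.
    by rewrite -[RHS](mulKmx bu) (mulmxA b) -bK mulmxK.
  by rewrite -mulmxA DK !mulmxA bK'.
rewrite mulKVmx // trmx_mul Ds trmx_inv -mulmxA mulVmx ?mulmx1 //.
by rewrite unitmx_tr.
Qed.

(** The real form of the complex scalar alpha + i beta; a quadruple block is diag(K, -K) for this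
    K. *)
Definition rot_block m (alpha beta : R) : 'M_(m + m) :=
  block_mx alpha%:M beta%:M (- beta)%:M alpha%:M.

Lemma J_block_quadruple m alpha beta :
  J_block Quadruple m alpha beta =
  block_mx (rot_block m alpha beta) 0 0 (- rot_block m alpha beta).
Proof. by rewrite /= /rot_block opp_block_mx !scalar_mxN opprK. Qed.

Lemma frakI_tr m : (frakI m)^T = frakI m :> 'M[R]_(m + m).
Proof. by rewrite tr_block_mx linearN /= trmx1 !trmx0. Qed.

(** In these coordinates [frakI] is complex conjugation, and the transpose is the real form of alpha
    - i beta. *)
Lemma frakI_rot_block m alpha beta :
  frakI m *m rot_block m alpha beta = (rot_block m alpha beta)^T *m frakI m.
Proof.
rewrite tr_block_mx !tr_scalar_mx !mulmx_block.
rewrite !mul1mx !mul0mx !mulmx0 !mulmx1 !add0r !addr0.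
by rewrite !mulNmx !mul1mx !mulmxN !mulmx1 !scalar_mxN opprK.
Qed.

Lemma rot_block_sum m alpha beta :
  rot_block m alpha beta + (rot_block m alpha beta)^T = (alpha *+ 2)%:M.
Proof.
rewrite tr_block_mx !tr_scalar_mx add_block_mx -!raddfD /= subrr addNr.
by rewrite -mulr2n raddf0 -scalar_mx_block.
Qed.

Lemma rot_block_norm m alpha beta :
  rot_block m alpha beta *m (rot_block m alpha beta)^T =
  (alpha ^+ 2 + beta ^+ 2)%:M.
Proof.
rewrite tr_block_mx !tr_scalar_mx mulmx_block -!scalar_mxM -!raddfD /=.
rewrite [RHS]scalar_mx_block mulrN mulNr mulrNN -!expr2 [beta * _]mulrC.
by congr block_mx; rewrite ?addNr ?subrr ?raddf0 // addrC.
Qed.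

(** Both K and K^T are roots of t^2 - 2 alpha t + (alpha^2 + beta^2). The equation gives (K^T)^2 M =
    M K^2; reducing both squares leaves 4 alpha M K = 0, and K is invertible because K K^T is a
    nonzero scalar. *)
Lemma rot_block_sylvester m alpha beta (M : 'M_(m + m)) : alpha != 0 ->
  (rot_block m alpha beta)^T *m M = - (M *m rot_block m alpha beta) -> M = 0.
Proof.
set K := rot_block m alpha beta => a0 KM.
have s0 : alpha ^+ 2 + beta ^+ 2 != 0.
  by rewrite gt_eqF // ltr_wpDr ?sqr_ge0 // lt0r sqrf_eq0 a0 sqr_ge0.
have KTE : K^T = (alpha *+ 2)%:M - K.
  by rewrite -(rot_block_sum m alpha beta) addrAC subrr add0r.
have KE : K = (alpha *+ 2)%:M - K^T by rewrite KTE opprB addrC subrK.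
have e1 : K^T *m (K^T *m M) = M *m (K *m K).
  by rewrite KM mulmxN (mulmxA K^T) KM mulNmx opprK mulmxA.
have e2 : K^T *m K^T = (alpha *+ 2) *: K^T - (alpha ^+ 2 + beta ^+ 2)%:M.
  by rewrite {1}KTE mulmxBl mul_scalar_mx rot_block_norm.
have e3 : K *m K = (alpha *+ 2) *: K - (alpha ^+ 2 + beta ^+ 2)%:M.
  by rewrite {2}KE mulmxBr mul_mx_scalar rot_block_norm.
have MK0 : M *m K = 0.
  move: e1; rewrite mulmxA e2 e3 mulmxBl mulmxBr -scalemxAl -scalemxAr KM.
  rewrite mul_scalar_mx mul_mx_scalar => /addIr /eqP.
  rewrite scalerN eq_sym -addr_eq0 -mulr2n -scaler_nat scalerA scaler_eq0.
  by rewrite mulf_eq0 pnatr_eq0 mulrn_eq0 /= (negPf a0) => /eqP.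
have : M *m (K *m K^T) = 0 by rewrite mulmxA MK0 mul0mx.
rewrite rot_block_norm mul_mx_scalar => /eqP.
by rewrite scaler_eq0 (negPf s0) => /eqP.
Qed.

Lemma block_normal_form kd m (alpha beta : R) (G : 'M_(block_size kd m)) :
  let J := J_block kd m alpha beta in
  block_param_pos kd alpha beta ->
  G^T = G -> J^T *m G = - (G *m J) -> G \in unitmx ->
  exists (T : 'M_(block_size kd m)) (e : 'I_m -> bool),
    T *m J = J *m T /\ T^T *m G *m T = Gamma_block kd e.
Proof.
case: kd G => /= G.
- case=> a0 b0 Gs GJ Gu.
  rewrite -/(J_block Quadruple m alpha beta) J_block_quadruple in GJ *.
  have [T [TJ TG]] := off_diagonal_normal_form
    (fun M => @rot_block_sylvester m alpha beta M (lt0r_neq0 a0))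
    (frakI_tr m) (frakI_rot_block m alpha beta) Gs GJ Gu.
  by exists T, (fun=> false).
- by move=> b0 Gs GJ Gu; apply: (imaginary_normal_form (lt0r_neq0 b0)).
- move=> a0 Gs GJ Gu.
  rewrite scalar_mxN in GJ *.
  (* A real pair is the case K = alpha I, D = I; the equation reads 2 alpha M = 0. *)
  have K0 (M : 'M_m) : alpha%:M^T *m M = - (M *m alpha%:M) -> M = 0.
    rewrite tr_scalar_mx mul_scalar_mx mul_mx_scalar => /eqP.
    rewrite -addr_eq0 -mulr2n -scaler_nat scalerA scaler_eq0.
    by rewrite mulf_eq0 pnatr_eq0 /= (negPf (lt0r_neq0 a0)) => /eqP.
  have DK : 1%:M *m alpha%:M = alpha%:M^T *m 1%:M :> 'M[R]_m.
    by rewrite tr_scalar_mx mul1mx mulmx1.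
  have [T [TJ TG]] :=
    off_diagonal_normal_form K0 (@trmx1 _ m) DK Gs GJ Gu.
  by exists T, (fun=> false).
- move=> _ Gs _ Gu; have [T [e TE]] := symmetric_diag Gs Gu.
  by exists T, e; rewrite mul0mx mulmx0.
Qed.

(** Since [Gamma] is the inverse of the Gram matrix, this lets the canonical form of one serve for
    the other. *)
Lemma Gamma_block_self_inverse kd m (e : 'I_m -> bool) :
  Gamma_block kd e *m Gamma_block kd e = 1%:M :> 'M[R]_(block_size kd m).
Proof.
have ss : sign_mx e *m sign_mx e = 1%:M :> 'M[R]_m.
  rewrite mul_diag_mx; apply/matrixP => i j; rewrite !mxE.
  by rewrite mulrnAr -expr2 sqrr_sign.
have FF : frakI m *m frakI m = 1%:M :> 'M[R]_(m + m).
  rewrite mulmx_block !mulmx0 !mul0mx !add0r !addr0.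
  by rewrite mulNmx mulmxN !mul1mx opprK -scalar_mx_block.
case: kd => //=; rewrite mulmx_block !mulmx0 !mul0mx ?add0r ?addr0.
- by rewrite FF -scalar_mx_block.
- by rewrite ss -scalar_mx_block.
- by rewrite mul1mx -scalar_mx_block.
Qed.

(** This is the similarity between a block and minus its transpose; it turns the skewness relation
    for off-diagonal blocks into Sylvester's equation. *)
Lemma J_block_Gamma_block kd m (alpha beta : R) (e : 'I_m -> bool) :
  J_block kd m alpha beta *m Gamma_block kd e =
  - (Gamma_block kd e *m (J_block kd m alpha beta)^T).
Proof.
case: kd => /=; last by rewrite trmx0 mul0mx mulmx0 oppr0.
- rewrite -/(J_block Quadruple m alpha beta) J_block_quadruple.
  set K := rot_block m alpha beta.
  have KD : frakI m *m K^T = K *m frakI m.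
    have KT : K^T = rot_block m alpha (- beta).
      by rewrite tr_block_mx !tr_scalar_mx /rot_block opprK.
    by rewrite KT frakI_rot_block -KT trmxK.
  move: (frakI m) K KD => D K KD.
  rewrite tr_block_mx !trmx0 [(- K)^T]linearN /= !mulmx_block.
  rewrite !mul0mx !mulmx0 !add0r !addr0 opp_block_mx !mulNmx !mulmxN !KD.
  by rewrite oppr0 opprK.
- rewrite !tr_block_mx !tr_scalar_mx !trmx0 !mulmx_block.
  rewrite !mul0mx !mulmx0 !add0r !addr0 opp_block_mx oppr0.
  by rewrite !mul_scalar_mx !mul_mx_scalar !scaleNr opprK.
- rewrite !tr_block_mx !tr_scalar_mx !trmx0 !mulmx_block.
  rewrite !mul1mx !mul0mx !mulmx0 !mulmx1 !add0r !addr0 opp_block_mx oppr0.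
  by rewrite !scalar_mxN opprK.
Qed.
End BlockNormalForms.

(** * The Gram matrix of a standard pair *)

Section StandardPairs.
Context {R : realType} {n k : nat}.
Implicit Types (A : 'I_k.+1 -> 'M[R]_n) (X : 'M[R]_(n, k * n)).
Implicit Types J : 'M[R]_(k * n).

(** Extending the coefficients by zero removes the case distinction from [calA] and allows free
    shifts of indices. *)
Definition coef A (j : nat) : 'M[R]_n := if (j <= k)%N then A (inord j) else 0.

Lemma calAE A : calA A = castmx (sum_block_sizes k n, sum_block_sizes k n)
  (\mxblock_(p < k, q < k) ((-1) ^+ p *: coef A (p + q + 1))).
Proof.
congr castmx; apply: eq_mxblock => p q; rewrite /coef.
by case: ifP => // _; rewrite scaler0.
Qed.

Lemma coef_tr A j : T_odd A -> (coef A j)^T = (-1) ^+ j.+1 *: coef A j.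
Proof.
move=> Aodd; rewrite /coef; case: ifP => jk; last by rewrite trmx0 scaler0.
rewrite Aodd inordK //= -signr_odd /=.
by case: (odd j); rewrite /= ?scale1r // expr1 scaleN1r.
Qed.

(** The transposed block at (p, q) has sign (-1)^q from its place and (-1)^(p+q+2) from T-oddness,
    together (-1)^p. *)
Lemma calA_tr A : T_odd A -> (calA A)^T = calA A.
Proof.
move=> Aodd; rewrite calAE trmx_cast /= tr_mxblock; congr castmx.
apply: eq_mxblock => p q; rewrite linearZ /= coef_tr // scalerA -exprD.
rewrite (addnC p q); congr (_ *: _); rewrite -[LHS]signr_odd -[RHS]signr_odd.
by rewrite addn1 !oddD /= !oddD; case: (odd p); case: (odd q).
Qed.

Lemma unitmx_cast m m' (e : m = m') (M : 'M[R]_m) :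
  (castmx (e, e) M \in unitmx) = (M \in unitmx).
Proof. by case: _ / e. Qed.

(* calA is zero below its block antidiagonal, where its blocks are +-A_k: the
   last row kills the first block of a kernel vector, and so on upwards. *)
Lemma calA_unit A : A ord_max \in unitmx -> calA A \in unitmx.
Proof.
move=> Ak; rewrite calAE unitmx_cast; set B := mxblock _.
rewrite -unitmx_tr -row_free_unit -kermx_eq0.
set W := (kermx B^T)^T; rewrite -[kermx _]trmxK -/W.
have BW : B *m W = 0 by rewrite -[B]trmxK -trmx_mul mulmx_ker trmx0.
suff W0 d (q : 'I_k) : (q < d)%N -> submxcol W q = 0.
  suff -> : W = 0 by rewrite trmx0.
  by apply/mxcolP => q; rewrite (W0 k) ?submxcol0.
elim: d q => // d IHd q; rewrite ltnS => qd.
(* Row [rev_ord q] is row k - 1 - q, so its column q carries +-A_k; the columns beyond q have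
   coefficient index above k. *)
have := congr1 (fun M => submxcol M (rev_ord q)) BW.
rewrite -[W in B *m W]submxcolK mul_mxblock_mxrow mxcolK submxcol0.
move=> rowE; rewrite [LHS](bigD1 q) //= [X in _ + X]big1 ?addr0 in rowE.
  move: rowE; rewrite addn1 -addnS subnK // /coef leqnn.
  have -> : inord k = ord_max :> 'I_k.+1 by apply/val_inj; rewrite /= inordK.
  rewrite -scalemxAl => /eqP; rewrite scaler_eq0 signr_eq0 /= => /eqP AW.
  by rewrite -[LHS](mulKmx Ak) AW mulmx0.
move=> q' q'q.
have [q'd|dq'] := ltnP q' d; first by rewrite IHd ?mulmx0.
rewrite /coef leqNgt (_ : (k < _)%N) ?scaler0 ?mul0mx //.
have qq' : (q < q')%N by rewrite ltn_neqAle eq_sym q'q (leq_trans qd).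
by rewrite addn1 ltnS -{1}(subnK (ltn_ord q)) leq_add2l.
Qed.

Definition gram A X J := (stack_mx X J)^T *m calA A *m stack_mx X J.

Lemma gramE A X J : gram A X J = \sum_(p < k) \sum_(q < k)
  (-1) ^+ p *: ((X *m J ^+ p)^T *m coef A (p + q + 1) *m (X *m J ^+ q)).
Proof.
have gen N (e : (\sum_(i < k) n)%N = N) B (C : 'M[R]_(\sum_(i < k) n, k * n)) :
    (castmx (e, erefl) C)^T *m castmx (e, e) B *m castmx (e, erefl) C =
    C^T *m B *m C by case: _ / e.
rewrite /gram /stack_mx calAE gen tr_mxcol mul_mxrow_mxblock mul_mxrow_mxcol.
rewrite exchange_big; apply: eq_bigr => q _; rewrite mulmx_suml.
by apply: eq_bigr => p _; rewrite -scalemxAr -scalemxAl.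
Qed.

Lemma gram_tr A X J : T_odd A -> (gram A X J)^T = gram A X J.
Proof. by move=> /calA_tr At; rewrite /gram !trmx_mul trmxK At mulmxA. Qed.

Lemma gram_unit A X J :
  A ord_max \in unitmx -> standard_pair A X J -> gram A X J \in unitmx.
Proof.
by move=> Ak [Xu _]; rewrite /gram !unitmx_mul unitmx_tr Xu calA_unit.
Qed.

(* With f p q = (-1)^p (X J^p)^T A_(p+q) (X J^q), the sum J^T G + G J
   telescopes to sum_q f 0 q - sum_p f p 0, and both sums vanish. *)
Lemma gram_skew A X J : (0 < k)%N -> T_odd A -> standard_pair A X J ->
  J^T *m gram A X J = - (gram A X J *m J).
Proof.
move=> k0 Aodd [_ AXJ].
pose f p q := (-1) ^+ p *: ((X *m J ^+ p)^T *m coef A (p + q) *m (X *m J ^+ q)).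
have coefk p q : (k < p + q)%N -> f p q = 0.
  by move=> pq; rewrite /f /coef leqNgt pq mulmx0 mul0mx scaler0.
have row0 : \sum_(q < k.+1) f 0%N q = 0.
  transitivity (X^T *m \sum_(i < k.+1) A i *m X *m J ^+ i); last first.
    by rewrite AXJ mulmx0.
  rewrite mulmx_sumr; apply: eq_bigr => q _.
  rewrite /f expr0 scale1r mulmx1 /coef -ltnS ltn_ord inord_val.
  by rewrite !mulmxA.
(* T-oddness turns (-1)^p A_p into - A_p^T, so the transposed equation of the standard pair
   appears. *)
have col0 : \sum_(p < k.+1) f p 0%N = 0.
  transitivity (- ((\sum_(i < k.+1) A i *m X *m J ^+ i)^T *m X)); last first.
    by rewrite AXJ trmx0 mul0mx oppr0.
  rewrite linear_sum /= mulmx_suml -sumrN; apply: eq_bigr => p _.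
  have -> : A p = coef A p by rewrite /coef -ltnS ltn_ord inord_val.
  rewrite /f addn0 mulmx1 -(mulmxA (coef A p)) [in RHS]trmx_mul coef_tr //.
  by rewrite -scalemxAr -scalemxAl -scaleNr exprS mulN1r opprK.
have JG : J^T *m gram A X J = - \sum_(p < k) \sum_(q < k) f p.+1 q.
  rewrite gramE mulmx_sumr -sumrN; apply: eq_bigr => p _.
  rewrite mulmx_sumr -sumrN; apply: eq_bigr => q _.
  rewrite -scalemxAr /f addn1 addSn exprS mulN1r scaleNr opprK.
  by rewrite exprSr (mulmxA X) [(X *m J ^+ p *m J)^T]trmx_mul !mulmxA.
have GJ : gram A X J *m J = \sum_(p < k) \sum_(q < k) f p q.+1.
  rewrite gramE mulmx_suml; apply: eq_bigr => p _.
  rewrite mulmx_suml; apply: eq_bigr => q _.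
  by rewrite -scalemxAl /f addn1 addnS exprSr !mulmxA.
have shift (g : nat -> 'M[R]_(k * n)) :
    \sum_(p < k) g p.+1 = \sum_(p < k) g p + g k - g 0%N.
  transitivity (\sum_(p < k.+1) g p - g 0%N); last by rewrite big_ord_recr.
  by rewrite big_ord_recl addrAC subrr add0r.
rewrite JG GJ; congr (- _).
rewrite (shift (fun p => \sum_(q < k) f p q)).
under [RHS]eq_bigr do rewrite shift.
rewrite sumrB big_split /=.
(* On the boundary p = k or q = k only the entry whose other index is 0 has coefficient index at
   most k. *)
have rowk : \sum_(q < k) f k q = f k 0%N.
  rewrite (bigD1 (Ordinal k0)) //= big1 ?addr0 // => q q0.
  by apply: coefk; rewrite -[X in (X < _)%N]addn0 ltn_add2l lt0n.
have colk : \sum_(p < k) f p k = f 0%N k.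
  rewrite (bigD1 (Ordinal k0)) //= big1 ?addr0 // => p p0.
  by apply: coefk; rewrite -[X in (X < _)%N]add0n ltn_add2r lt0n.
move: row0 col0; rewrite !big_ord_recr /= rowk colk.
move=> /(canRL (addrK _)) -> /(canRL (addrK _)) ->.
by rewrite !add0r !opprK -!addrA [f k _ + _]addrC.
Qed.
End StandardPairs.

(** * Reduction to block diagonal form *)

Lemma stack_mxM (R : realType) n k (X : 'M[R]_(n, k * n)) (J T : 'M_(k * n)) :
  T *m J = J *m T -> stack_mx (X *m T) J = stack_mx X J *m T.
Proof.
move=> TJ; have TJi i : T *m J ^+ i = J ^+ i *m T.
  by apply/commrX.
have gen N (e : (\sum_(i < k) n)%N = N) (C : 'M[R]_(\sum_(i < k) n, k * n)) :
    castmx (e, erefl) (C *m T) = castmx (e, erefl) C *m T by case: _ / e.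
rewrite /stack_mx -gen mxcol_mul; congr castmx; apply: eq_mxcol => i.
by rewrite -!mulmxA TJi.
Qed.

Lemma standard_pairM (R : realType) n k (A : 'I_k.+1 -> 'M[R]_n) X J T :
  T *m J = J *m T -> T \in unitmx ->
  standard_pair A X J -> standard_pair A (X *m T) J.
Proof.
move=> TJ Tu [Xu AXJ]; split; first by rewrite stack_mxM // unitmx_mul Xu.
transitivity ((\sum_(i < k.+1) A i *m X *m J ^+ i) *m T).
  rewrite mulmx_suml; apply: eq_bigr => i _.
  by rewrite -!mulmxA; congr (_ *m (_ *m _)); apply/commrX.
by rewrite AXJ mul0mx.
Qed.

(** The size [N] is a variable so that the cast along [eN] disappears once the equation is
    destructed. *)
Lemma block_diagonal_normal_form (R : realType) s (kd : 'I_s -> block_kind)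
    (m : 'I_s -> nat) (alpha beta : 'I_s -> R) N
    (eN : (\sum_(j < s) block_size (kd j) (m j) = N)%N) (J G : 'M_N) :
  (forall j, block_param_pos (kd j) (alpha j) (beta j)) ->
  (forall i j, i != j -> forall z,
     ~ (spectrum (J_block (kd i) (m i) (alpha i) (beta i)) z /\
        spectrum (J_block (kd j) (m j) (alpha j) (beta j)) z)) ->
  J = castmx (eN, eN)
    (\mxdiag_(j < s) J_block (kd j) (m j) (alpha j) (beta j)) ->
  G^T = G -> J^T *m G = - (G *m J) -> G \in unitmx ->
  exists (T : 'M_N) (e : forall j : 'I_s, 'I_(m j) -> bool),
    let D := castmx (eN, eN) (\mxdiag_(j < s) Gamma_block (kd j) (e j)) in
    [/\ T *m J = J *m T, T^T *m G *m T = D & D *m D = 1%:M].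
Proof.
case: N / eN in J G *; rewrite castmx_id => pos disj JE Gs GJ Gu.
pose Jb j := J_block (kd j) (m j) (alpha j) (beta j).
pose B i j := submxblock G i j.
have GB : G = \mxblock_(i, j) B i j by rewrite submxblockK.
have BJ i j : (Jb i)^T *m B i j = - (B i j *m Jb j).
  move: i j; apply/eq_mxblockP; move: GJ.
  by rewrite JE GB tr_mxdiag mul_mxdiag_mxblock mul_mxblock_mxdiag -mxblockN.
have B0 i j : i != j -> B i j = 0.
  move=> ij; pose E : 'M[R]_(block_size (kd i) (m i)) :=
    Gamma_block (kd i) (fun=> false).
  (* By the similarity through [E], the product [E *m B i j] intertwines [Jb i] and [Jb j], whose
     spectra are disjoint. *)
  suff E0 : E *m B i j = 0.
    by rewrite -[LHS]mul1mx -(Gamma_block_self_inverse _ (fun=> false)) -mulmxA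
      E0 mulmx0.
  apply: (@sylvester_eq0 R _ _ (Jb i) (Jb j) (E *m B i j)).
    by move=> z; apply: disj.
  rewrite mulmxA J_block_Gamma_block mulNmx -!mulmxA BJ.
  by rewrite mulmxN opprK.
have GD : G = \mxdiag_i B i i.
  rewrite [LHS]GB; apply: eq_mxblock => i j.
  case: eqVneq => [->|/B0 //]; by rewrite conform_mx_id.
(* The i-th diagonal block of G G^-1 = 1 gives a right inverse of [B i i], as [G] is block
   diagonal. *)
have Bu i : B i i \in unitmx.
  have : G *m invmx G = 1%:M by rewrite mulmxV.
  rewrite {1}GD -[invmx G]submxblockK mul_mxdiag_mxblock -mxdiagZ.
  move=> /(congr1 (fun M => submxblock M i i)).
  by rewrite mxblockK submxblock_diag => /mulmx1_unit[].
have Bs i : (B i i)^T = B i i by rewrite tr_submxblock Gs.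
have /fin_all_exists[Te TeP] i : exists Te : 'M_(block_size (kd i) (m i)) *
    ('I_(m i) -> bool), Te.1 *m Jb i = Jb i *m Te.1 /\
    Te.1^T *m B i i *m Te.1 = Gamma_block (kd i) Te.2.
  have [T [e TP]] := block_normal_form (pos i) (Bs i) (BJ i i) (Bu i).
  by exists (T, e).
exists (\mxdiag_i (Te i).1), (fun i => (Te i).2); rewrite castmx_id.
have mulD (M1 M2 : forall i, 'M[R]_(block_size (kd i) (m i))) :
    \mxdiag_i M1 i *m \mxdiag_i M2 i = \mxdiag_i (M1 i *m M2 i).
  rewrite {2}/mxdiag mul_mxdiag_mxblock; apply: eq_mxblock => i j.
  case: eqVneq => [->|_]; first by rewrite !conform_mx_id.
  by rewrite mulmx0.
split.
- by rewrite JE !mulD; apply: eq_mxdiag => i; case: (TeP i).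
- by rewrite GD tr_mxdiag !mulD; apply: eq_mxdiag => i; case: (TeP i).
- rewrite mulD -mxdiagZ; apply: eq_mxdiag => i.
  exact: Gamma_block_self_inverse.
Qed.

Theorem theorem3p9 (R : realType) (n k : nat) (hn : (1 <= n)%N) (hk : (2 <= k)%N)
    (A : 'I_k.+1 -> 'M[R]_n)
    (hodd : T_odd A)
    (hlead : A ord_max \in unitmx)
    (hsemi : all_semisimple A)
    (s r1 r2 : nat) (hr12 : (r1 <= r2)%N) (hr2s : (r2 < s)%N)
    (m : 'I_s -> nat) (alpha beta : 'I_s -> R)
    (hpos : forall j : 'I_s,
       block_param_pos (kind_of r1 r2 s j) (alpha j) (beta j))
    (hsize : (\sum_(j < s) block_size (kind_of r1 r2 s j) (m j) = k * n)%N)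
    (hdisj : forall i j : 'I_s, i != j -> forall z : R[i],
       ~ (spectrum (J_block (kind_of r1 r2 s i) (m i) (alpha i) (beta i)) z /\
          spectrum (J_block (kind_of r1 r2 s j) (m j) (alpha j) (beta j)) z))
    (X : 'M[R]_(n, k * n)) (J : 'M[R]_(k * n))
    (hJ : J = castmx (hsize, hsize)
       (\mxdiag_(j < s) J_block (kind_of r1 r2 s j) (m j) (alpha j) (beta j)))
    (hXJ : standard_pair A X J) :
  exists X' : 'M[R]_(n, k * n),
    standard_pair A X' J /\
    in_S J (Gamma A X' J) /\
    exists e : forall j : 'I_s, 'I_(m j) -> bool,
      Gamma A X' J = castmx (hsize, hsize)
        (\mxdiag_(j < s) Gamma_block (kind_of r1 r2 s j) (e j)).
Proof.
have k0 : (0 < k)%N by apply: ltnW.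
have [T [e [TJ TG DD]]] := block_diagonal_normal_form hpos hdisj hJ
  (gram_tr X J hodd) (gram_skew k0 hodd hXJ) (gram_unit hlead hXJ).
set D := castmx _ _ in TG DD.
have [Du _] := mulmx1_unit DD.
(* [T] is a right factor of the invertible product T^T G T = D. *)
have Tu : T \in unitmx by move: Du; rewrite -TG unitmx_mul => /andP[].
have hXT := standard_pairM TJ Tu hXJ.
have gramT : gram A (X *m T) J = D.
  by rewrite -TG /gram stack_mxM // trmx_mul !mulmxA.
have GammaE : Gamma A (X *m T) J = D.
  by rewrite /Gamma -/(gram A (X *m T) J) gramT -[RHS](mulKmx Du) DD mulmx1.
exists (X *m T); split=> //; rewrite GammaE; split; last by exists e.
have := gram_tr (X *m T) J hodd; have := gram_skew k0 hodd hXT.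
rewrite /in_S gramT => DJ Ds; split=> //.
(* Multiplying J^T D = - D J by [D] on both sides and using D D = 1 gives D J^T = - J D. *)
rewrite -[LHS]mulmx1 -DD !mulmxA -(mulmxA D) DJ mulmxN mulNmx mulmxA DD mul1mx.
by [].
Qed.
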